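(* Let $K$ be a field, $A$ a central simple $K$-algebra and $FA$ a filtration on $A$ with $B=F_0A$ such that the negative part $$F^-B:\quad B=F_0A\supset F_{-1}A\supset F_{-2}A\supset\cdots$$ is an irreducible left $FA$-glider. Let $e\ge1$ be the smallest integer such that $F_{-e}A\supsetneq F_{-e-1}A$. Then $FA$ is a strong $e$-step filtration.
   Context: A filtration $FA$ on $A$ is an ascending chain $(F_nA)_{n\in\mathbb{Z}}$ of additive subgroups with $F_nA\,F_mA\subset F_{n+m}A$, $F_0A$ being a subring. All filtrations are assumed separated ($\bigcap_nF_nA=0$), exhaustive ($\bigcup_nF_nA=A$) and not bounded (all $F_nA\neq0$, no $m$ with $F_mA=A$). The induced filtration on $K$ is $F_nK=F_nA\cap K$; it is assumed to have non-trivial negative part, i.e. $F_{-n}K\ne0$ for all $n\ge0$. $FA$ is strong if $F_nA\,F_{-n}A=F_0A=F_{-n}A\,F_nA$ for all $n\ge0$. $FA$ is a strong $e$-step filtration if $F_{ne}A=F_{ne+1}A=\cdots=F_{ne+e-1}A$ for all $n\in\mathbb{Z}$ and the filtration $n\mapsto F_{ne}A$ is strong. A left $FA$-glider (inside a left $A$-module $\Omega$) is a descending chain $M=M_0\supset M_1\supset\cdots$ of left $F_0A$-submodules of $\Omega$ such that $F_iA\,M_j\subset M_{j-i}$ for all $i\in\mathbb{Z}$, $j\in\mathbb{N}$, $i\le j$. Its body is $B(M)=\bigcap_jM_j$. A subglider of $M$ is a glider $N_0\supset N_1\supset\cdots$ with $N_i\subset M_i$ for all $i$. It is trivial if: $(T_1)$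 there is $n\in\mathbb{N}$ with $N_n=B(N)$ but $M_n\ne B(M)$; or $(T_2)$ there is $n$ with $N_n=0$ but $M_n\ne0$; or $(T_3)$ there is a monotone increasing $\alpha:\mathbb{N}\to\mathbb{N}$ with $N_n=M_{\alpha(n)}$ for all $n$ and $\alpha(n)-m\ge\alpha(n-m)$ for all $m\le n$. A glider is irreducible if it is nonzero and all its subgliders are trivial. *)

(* Defs.v *)
From HB Require Import structures.
From mathcomp Require Import all_boot all_order all_algebra all_field.
From mathcomp Require Import boolp classical_sets.

Set Implicit Arguments.
Unset Strict Implicit.
Unset Printing Implicit Defensive.

Import Order.TTheory GRing.Theory Num.Theory.

Local Open Scope classical_set_scope.
Local Open Scope ring_scope.

Definition two_sided_ideal (R : pzRingType) (I : set R) : Prop :=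
  zmod_closed [in I] /\ forall a x : R, I x -> I (a * x) /\ I (x * a).

(* A falgType is finite-dimensional and nonzero by definition. *)
Definition central_simple (K : fieldType) (A : falgType K) : Prop :=
  ('Z({:A}) = 1)%VS /\
  forall I : set A, two_sided_ideal I -> I = [set 0] \/ I = setT.

(* The product of additive subgroups is the additive subgroup generated by the
   products, i.e. it consists of finite sums. *)
Definition mul_subgroup (R : pzRingType) (S T : set R) : set R :=
  [set x | exists2 s : seq (R * R),
     (forall p, p \in s -> S p.1 /\ T p.2) & x = \sum_(p <- s) p.1 * p.2].

Record is_filtration (R : pzRingType) (F : int -> set R) : Prop := IsFiltration {
  filt_ascending : forall m n : int, m <= n -> F m `<=` F n ;
  filt_subgroup : forall n : int, zmod_closed [in F n] ;
  filt_mul : forall m n : int, mul_subgroup (F n) (F m) `<=` F (n + m) ;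
  filt_subring : subring_closed [in F 0]
}.

Definition separated_filtration (R : pzRingType) (F : int -> set R) : Prop :=
  \bigcap_n F n = [set 0].

Definition exhaustive_filtration (R : pzRingType) (F : int -> set R) : Prop :=
  \bigcup_n F n = setT.

Definition not_bounded_filtration (R : pzRingType) (F : int -> set R) : Prop :=
  (forall n : int, F n <> [set 0]) /\ ~ (exists m : int, F m = setT).

(* The trace of F on K, identified with its image K1 in A. *)
Definition induced_filtration (K : fieldType) (A : falgType K)
    (F : int -> set A) (n : int) : set K :=
  [set k : K | F n k%:A].

Definition nontrivial_negative_part (R : pzRingType) (F : int -> set R) : Prop :=
  forall n : nat, F (- n%:Z) <> [set 0].

Definition strong_filtration (R : pzRingType) (F : int -> set R) : Prop :=
  forall n : int, 0 <= n ->
    mul_subgroup (F n) (F (- n)) = F 0 /\ mul_subgroup (F (- n)) (F n) = F 0.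

Definition strong_step_filtration (R : pzRingType) (e : nat)
    (F : int -> set R) : Prop :=
  (forall (n : int) (i : nat), (i < e)%N -> F (n * e%:Z + i%:Z) = F (n * e%:Z)) /\
  strong_filtration (fun n : int => F (n * e%:Z)).

Section Gliders.
Variables (R : pzRingType) (F : int -> set R) (Omega : lmodType R).
Implicit Types M N : nat -> set Omega.

Record is_glider M : Prop := IsGlider {
  glider_descending : forall j : nat, M j.+1 `<=` M j ;
  glider_subgroup : forall j : nat, zmod_closed [in M j] ;
  glider_submod : forall (j : nat) (b : R) (x : Omega),
    F 0 b -> M j x -> M j (b *: x) ;
  (* `|j - i|%N is j - i as a natural number, since i <= j. *)
  glider_act : forall (i : int) (j : nat) (a : R) (x : Omega),
    i <= j%:Z -> F i a -> M j x -> M `|j%:Z - i|%N (a *: x)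
}.

Definition glider_body M : set Omega := \bigcap_j M j.

Definition is_subglider N M : Prop :=
  is_glider N /\ forall i : nat, N i `<=` M i.

Definition trivial_T1 N M : Prop :=
  exists n : nat, N n = glider_body N /\ M n <> glider_body M.

Definition trivial_T2 N M : Prop :=
  exists n : nat, N n = [set 0] /\ M n <> [set 0].

Definition trivial_T3 N M : Prop :=
  exists alpha : nat -> nat,
    [/\ {homo alpha : m n / (m <= n)%N},
        (forall n : nat, N n = M (alpha n)) &
        (* compared in int, to avoid truncated subtraction *)
        forall m n : nat, (m <= n)%N ->
          (alpha (n - m)%N)%:Z <= (alpha n)%:Z - m%:Z].

Definition trivial_subglider N M : Prop :=
  [\/ trivial_T1 N M, trivial_T2 N M | trivial_T3 N M].

Definition irreducible_glider M : Prop :=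
  [/\ is_glider M, M 0%N <> [set 0] &
      forall N, is_subglider N M -> trivial_subglider N M].

End Gliders.

(* The chain F_0 A, F_{-1} A, ... inside the left regular module A^o. *)
Definition negative_part (R : pzRingType) (F : int -> set R) (i : nat) : set R^o :=
  F (- i%:Z).

(* Main.v *)
Require Import Defs.
From HB Require Import structures.
From mathcomp Require Import all_boot all_order all_algebra all_field.
From mathcomp Require Import boolp classical_sets zify.

Set Implicit Arguments.
Unset Strict Implicit.
Unset Printing Implicit Defensive.

Import Order.TTheory GRing.Theory Num.Theory.

Local Open Scope classical_set_scope.
Local Open Scope ring_scope.

(** Write B for F_0. For x nonzero in B the chain F_0 x, F_(-1) x, ... is a
    subglider of the negative part. It is never zero, because every F_(-n)
    contains a central unit, and its body is 0; so irreducibility makes it a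
    subsequence of the negative part ([right_multiple_shift]). In particular
    each nonzero principal left ideal B x is some F_(-k). It contains a central
    unit, so x is a unit of A, and A is a division ring ([unit_of_neq0]). As
    the F_(-k) form a chain, B is a valuation ring ([subring_total]), and an
    element pi of F_(-e) outside F_(-e-1) generates the maximal ideal F_(-1),
    which equals F_(-e).
    Conjugation by pi stabilises B in both directions ([conj_uniformizer],
    [conjV_uniformizer]), so the B pi^m multiply like ideal powers, and every
    F_n is one of them ([filt_uniformizer_power]).

    The filtration is thus encoded by a function p with F_(-n) = B pi^(p n),
    which is nondecreasing and subadditive, equal to 1 on [1, e], and greater
    than 1 afterwards. It remains to see that p n is n / e rounded up. Two
    further uses of irreducibility give this:
    - the glider of right multiples by pi^s embeds each fibre of p on the
      naturals, without shrinking distances, into the fibre s steps further on: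
      the steps of p never get shorter;
    - the chain F_(-1), F_(-1), F_(-2), ..., where only the first term of the
      negative part has been changed, repeats F_(-e) e + 1 times and so is not
      a subsequence of the negative part. Hence it is not a glider, and
      F_j F_(-j) is not contained in F_(-1) for some j > 0, that is,
      p (- j) = - p j ([exists_strong_index]). This makes p quasi-periodic.
    Subadditivity bounds p (n + e) by p n + 1. If p (n + e) were p n, the step
    of n, longer than e, could be transported into a translate of the first
    step, whose length is e. So p (n + e) = p n + 1, for negative n too by
    quasi-periodicity ([step_shift]). *)

(** * Quasi-periodic step functions *)

Section StepFunction.
Variables (p : int -> int) (e : nat).
Hypothesis p_homo : forall m n : int, m <= n -> p m <= p n.
Hypothesis p_subadd : forall m n : int, p (m + n) <= p m + p n.
Hypothesis p0 : p 0 = 0.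
Hypothesis p1 : p 1 = 1.
Hypothesis pe : p e%:Z = 1.
Hypothesis pe1 : 2 <= p (e%:Z + 1).
Hypothesis p_embed : forall s : nat, exists2 alpha : nat -> nat,
  (forall n : nat, p (alpha n)%:Z = p n%:Z + s%:Z) &
  forall m n : nat, (alpha m + n <= alpha (m + n))%N.
Variable j : nat.
Hypothesis j_gt0 : (0 < j)%N.
Hypothesis p_oppj : p (- j%:Z) = - p j%:Z.

(** Subadditivity bounds p (n + j) by p n + p j, and, applied to - j, bounds
    p n by p (n + j) - p j. *)
Lemma step_periodic (t : nat) (n : int) :
  p (n + (t * j)%N%:Z) = p n + t%:Z * p j%:Z.
Proof.
have shift m : p (m + j%:Z) = p m + p j%:Z.
  have := p_subadd (m + j%:Z) (- j%:Z); rewrite addrK p_oppj.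
  have := p_subadd m j%:Z; lia.
elim: t n => [|t IH] n; first by rewrite mul0n mul0r !addr0.
rewrite mulSn PoszD addrA IH shift; lia.
Qed.

Lemma step_ge1 (i : int) : 1 <= p i -> 1 <= i.
Proof.
have [//|i_lt1 pi1] := leP 1 i.
have : p i <= p 0 by apply: p_homo; lia.
rewrite p0; lia.
Qed.

Lemma step_le_e (i : int) : p i <= 1 -> i <= e%:Z.
Proof.
have [//|i_gt_e pi1] := leP i e%:Z.
have : p (e%:Z + 1) <= p i by apply: p_homo; lia.
lia.
Qed.

Lemma period_gt0 : 1 <= p j%:Z.
Proof. by rewrite -p1; apply: p_homo; lia. Qed.

(** If p took the same value at n and n + e, the embedding would carry these
    e + 1 integers into a translate, by a multiple of j, of the fibre of p over
    1, which has only e elements. *)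
Lemma step_shift_nat (n : nat) : p (n%:Z + e%:Z) = p n%:Z + 1.
Proof.
have le1 := p_subadd n%:Z e%:Z; have mono : p n%:Z <= p (n%:Z + e%:Z).
  by apply: p_homo; lia.
have [//|neq] := eqVneq (p (n%:Z + e%:Z)) (p n%:Z + 1).
have flat : p (n%:Z + e%:Z) = p n%:Z by lia.
have pn_ge0 : 0 <= p n%:Z by rewrite -p0; apply: p_homo; lia.
have pj := period_gt0.
pose t := absz (p n%:Z).
have tpj : p n%:Z <= t%:Z * p j%:Z by rewrite /t /=; nia.
(* s steps beyond p n lies the value 1 + t * p j, taken on [1, e] + t * j. *)
pose s := absz (t%:Z * p j%:Z + 1 - p n%:Z)%R.
have [alpha alphaE alpha_inc] := p_embed s.
have back m : p m%:Z = p n%:Z -> p ((alpha m)%:Z - (t * j)%N%:Z) = 1.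
  move=> pm; have := step_periodic t ((alpha m)%:Z - (t * j)%N%:Z).
  rewrite subrK alphaE pm /s; lia.
have lo : 1 <= (alpha n)%:Z - (t * j)%N%:Z.
  by apply: step_ge1; rewrite (back n).
have hi : (alpha (n + e)%N)%:Z - (t * j)%N%:Z <= e%:Z.
  by apply: step_le_e; rewrite (back (n + e)%N).
have := alpha_inc n e; lia.
Qed.

(** The case of a natural n extends to all n because p is quasi-periodic. *)
Lemma step_shift (n : int) : p (n + e%:Z) = p n + 1.
Proof.
pose t := absz n; have tj : (t <= t * j)%N by rewrite leq_pmulr.
have [m def_m] : exists m : nat, n + (t * j)%N%:Z = m.
  by exists (absz (n + (t * j)%N%:Z)%R); lia.
have := step_periodic t (n + e%:Z).
rewrite addrAC def_m step_shift_nat -def_m step_periodic; lia.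
Qed.

Lemma step_shiftM (m n : int) : p (m + n * e%:Z) = p m + n.
Proof.
elim/int_rect: n => [|n IH|n IH]; first by rewrite mul0r !addr0.
  have -> : m + n.+1%:Z * e%:Z = m + n%:Z * e%:Z + e%:Z.
    by rewrite -addn1 PoszD mulrDl mul1r addrA.
  rewrite step_shift IH; lia.
have := step_shift (m + - n.+1%:Z * e%:Z).
have -> : m + - n.+1%:Z * e%:Z + e%:Z = m + - n%:Z * e%:Z.
  by rewrite -addn1 PoszD opprD mulrDl mulN1r addrA subrK.
move=> shift; apply: (addIr 1); rewrite -shift IH -addn1 PoszD opprD.
by rewrite addrA subrK.
Qed.

(** For 0 < i < e the integer e - i lies in [1, e], where p is 1. *)
Lemma step_ceil (n : int) (i : nat) :
  (i < e)%N -> p (- (n * e%:Z + i%:Z)) = - n.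
Proof.
move=> lt_ie; have -> : - (n * e%:Z + i%:Z) = - i%:Z + - n * e%:Z by lia.
rewrite step_shiftM; have := step_shift (- i%:Z).
case: i lt_ie => [|i] lt_ie; first by move=> _; rewrite oppr0 p0 add0r.
have le_p1 : p (- i.+1%:Z + e%:Z) <= p e%:Z by apply: p_homo; lia.
have ge_p1 : p 1 <= p (- i.+1%:Z + e%:Z) by apply: p_homo; lia.
move: le_p1 ge_p1; rewrite pe p1 => le_p1 ge_p1.
have -> : p (- i.+1%:Z + e%:Z) = 1 by apply: le_anti; rewrite le_p1.
by move/eqP; rewrite eq_sym -subr_eq0 addrK => /eqP ->; rewrite add0r.
Qed.
End StepFunction.


(** * Filtrations *)

Section Filtration.
Variables (R : pzRingType) (F : int -> set R).
Hypothesis F_filt : is_filtration F.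

Lemma filt0 n : F n 0.
Proof. by have [/set_mem] := filt_subgroup F_filt n. Qed.

Lemma filtB n a b : F n a -> F n b -> F n (a - b).
Proof.
move=> Fa Fb; have [_ closedB] := filt_subgroup F_filt n.
by apply/set_mem/closedB; apply: mem_set.
Qed.

Lemma filtM m n a b : F m a -> F n b -> F (m + n) (a * b).
Proof.
move=> Fa Fb; apply: (filt_mul F_filt).
exists [:: (a, b)]; last by rewrite big_seq1.
by move=> p; rewrite inE => /eqP ->.
Qed.

Lemma filt1 : F 0 1.
Proof. by have [/set_mem] := filt_subring F_filt. Qed.

Lemma filtS m n a : m <= n -> F m a -> F n a.
Proof. by move=> le_mn; apply: filt_ascending. Qed.

Hypothesis F_sep : separated_filtration F.

Lemma filt_separated a : (forall n : nat, F (- n%:Z) a) -> a = 0.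
Proof.
move=> Fa; suff : (\bigcap_n F n) a by rewrite F_sep.
by move=> n _; apply: filtS (Fa (absz n)); lia.
Qed.

Hypothesis F_neq0 : forall n : int, F n <> [set 0].

Lemma filt_neq0 n : exists2 a, F n a & a != 0.
Proof.
apply: contra_notP (F_neq0 (n := n)) => noa; apply/seteqP; split => a /=.
  by move=> Fa; apply: contra_notP noa => /eqP a_neq0; exists a.
by move->; apply: filt0.
Qed.
End Filtration.

(** * The division ring attached to an irreducible negative part *)

Section IrreducibleNegativePart.
Variables (R : unitRingType) (F : int -> set R).
Hypothesis F_filt : is_filtration F.
Hypothesis F_sep : separated_filtration F.
Hypothesis F_exh : exhaustive_filtration F.
Hypothesis F_neq0 : forall n : int, F n <> [set 0].
Hypothesis F_neqT : forall n : int, F n <> setT.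
Hypothesis F_central : forall n : nat, exists c,
  [/\ F (- n%:Z) c, c \is a GRing.unit & forall x, c * x = x * c].
Hypothesis F_irr : irreducible_glider F (negative_part F).

(** The body of the negative part is 0, so for a chain without zero term the
    two degenerate forms of triviality are excluded. *)
Lemma subglider_T3 (N : nat -> set R) :
  is_subglider F (N : nat -> set R^o) (negative_part F) ->
  (forall n, exists2 x, N n x & x != 0) ->
  exists2 alpha : nat -> nat, (forall n, N n = F (- (alpha n)%:Z)) &
    forall m n, (alpha m + n <= alpha (m + n))%N.
Proof.
move=> N_sub N_neq0; have [_ _ /(_ N N_sub)] := F_irr.
have N0 n : N n <> [set 0].
  have [x Nx /eqP x_neq0] := N_neq0 n => N_eq.
  by apply: x_neq0; move: Nx; rewrite N_eq.
case=> [[n [N_body _]]|[n [/N0]]|[alpha [_ NE alpha_inc]]] //.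
  have [x Nx /eqP[]] := N_neq0 n.
  apply: (filt_separated F_filt F_sep) => m.
  by have [_] := N_sub; apply; move: Nx; rewrite N_body; apply.
exists alpha => [n|m n]; first exact: NE.
have := alpha_inc n (m + n)%N (leq_addl _ _); rewrite addnK; lia.
Qed.

Definition right_multiple (x : R) (n : nat) : set R :=
  [set a | exists2 b, F (- n%:Z) b & a = b * x].

Lemma right_multiple_subglider x : F 0 x ->
  is_subglider F (right_multiple x : nat -> set R^o) (negative_part F).
Proof.
move=> Fx; split=> [|n a [b Fb ->]]; last first.
  by rewrite /negative_part -[- _]addr0; apply: filtM.
split=> [n a [b Fb ->]|n|n a _ Fa [b Fb ->]|i n a _ le_in Fa [b Fb ->]].
- by exists b => //; apply: filtS Fb => //; lia.
- split=> [|_ _ /set_mem[b Fb ->] /set_mem[c Fc ->]].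
    by apply/mem_set; exists 0; rewrite ?mul0r //; apply: filt0.
  by apply/mem_set; exists (b - c); rewrite ?mulrBl //; apply: filtB.
- exists (a * b); last by rewrite -mulrA.
  by rewrite -[- _]add0r; apply: filtM.
- exists (a * b); last by rewrite -mulrA.
  by rewrite gez0_abs ?subr_ge0 // opprB; apply: filtM.
Qed.

Lemma right_multiple_shift x : F 0 x -> x != 0 ->
  exists2 alpha : nat -> nat,
    (forall n, right_multiple x n = F (- (alpha n)%:Z)) &
    forall m n, (alpha m + n <= alpha (m + n))%N.
Proof.
move=> Fx x_neq0; apply: subglider_T3; first exact: right_multiple_subglider.
move=> n; have [c [Fc c_unit _]] := F_central n.
exists (c * x); first by exists c.
by apply: contraNneq x_neq0 => cx0; rewrite -(mulKr c_unit x) cx0 mulr0.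
Qed.

(** The degree 0 term of the previous chains. *)
Lemma principal_ideal x : F 0 x -> x != 0 ->
  exists k : nat, forall a, F (- k%:Z) a <-> exists2 b, F 0 b & a = b * x.
Proof.
move=> Fx x_neq0; have [alpha xE _] := right_multiple_shift Fx x_neq0.
by exists (alpha 0%N) => a; rewrite -xE.
Qed.

(** B x is some F_(-k), hence contains a central unit. *)
Lemma central_multiple x : F 0 x -> x != 0 ->
  exists b, [/\ F 0 b, b != 0, b * x \is a GRing.unit &
    forall y, b * x * y = y * (b * x)].
Proof.
move=> Fx x_neq0; have [k xE] := principal_ideal Fx x_neq0.
have [c [Fc c_unit c_central]] := F_central k; have [b Fb cE] := (xE c).1 Fc.
exists b; rewrite -cE; split => //.
by apply: contraTneq c_unit => b0; rewrite cE b0 mul0r unitr0.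
Qed.

(** By [central_multiple], both x and its cofactor b have a left inverse; b also
    has a right inverse, because b x is central and invertible. *)
Lemma subring_unit x : F 0 x -> x != 0 -> x \is a GRing.unit.
Proof.
move=> Fx x_neq0.
have [b [Fb b_neq0 bx_unit bxC]] := central_multiple Fx x_neq0.
have [d [_ _ db_unit _]] := central_multiple Fb b_neq0.
have right_inv : b * (x * (b * x)^-1) = 1 by rewrite mulrA mulrV.
have left_inv : (d * b)^-1 * d * b = 1 by rewrite -mulrA mulVr.
have b_unit : b \is a GRing.unit.
  apply/unitrP; exists (x * (b * x)^-1); split => //.
  by rewrite -[x * _]mul1r -left_inv -[_ * b * _]mulrA right_inv mulr1.
by rewrite -(unitrMr _ b_unit).
Qed.

(** A central unit of F_(-n) multiplies F_n into B. *)
Lemma unit_of_neq0 (a : R) : a != 0 -> a \is a GRing.unit.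
Proof.
move=> a_neq0.
have [n Fa] : exists n : nat, F n a.
  have [n _ Fa] : (\bigcup_n F n) a by rewrite F_exh.
  by exists (absz n); apply: filtS Fa => //; lia.
have [c [Fc c_unit _]] := F_central n; rewrite -(unitrMr _ c_unit).
apply: subring_unit; last first.
  by apply: contraNneq a_neq0 => ca0; rewrite -(mulKr c_unit a) ca0 mulr0.
by rewrite -(addNr n%:Z); apply: filtM.
Qed.

(** A nonzero a is the quotient of c a and c, both in B, and the left ideals
    that they generate are comparable, being terms of the filtration. *)
Lemma subring_total (a : R) : a != 0 -> F 0 a \/ F 0 a^-1.
Proof.
move=> a_neq0; have a_unit := unit_of_neq0 a_neq0.
have [n Fa] : exists n : nat, F n a.
  have [n _ Fa] : (\bigcup_n F n) a by rewrite F_exh.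
  by exists (absz n); apply: filtS Fa => //; lia.
have [c [Fnc c_unit cC]] := F_central n.
have Fc : F 0 c by apply: filtS Fnc => //; lia.
have Fca : F 0 (c * a) by rewrite -(addNr n%:Z); apply: filtM.
have ca_unit : c * a \is a GRing.unit by rewrite unitrMr.
have neq0 (x : R) : x \is a GRing.unit -> x != 0.
  by apply: contraTneq => ->; rewrite unitr0.
have [k caE] := principal_ideal Fca (neq0 _ ca_unit).
have [l cE] := principal_ideal Fc (neq0 _ c_unit).
have [le_lk|lt_kl] := leqP l k.
  have /cE[b Fb cab] : F (- l%:Z) (c * a).
    apply: filtS (_ : F (- k%:Z) _) => //; first lia.
    by apply/caE; exists 1; rewrite ?mul1r //; apply: filt1.
  by left; rewrite -(mulKr c_unit a) cab -cC mulKr.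
have /caE[b Fb cbca] : F (- k%:Z) c.
  apply: filtS (_ : F (- l%:Z) _) => //; first lia.
  by apply/cE; exists 1; rewrite ?mul1r //; apply: filt1.
right; suff -> : a^-1 = b by [].
apply: (mulIr a_unit); rewrite mulVr //; apply: (mulrI c_unit).
by rewrite mulr1 mulrA cC -mulrA -cbca.
Qed.

(** Otherwise 1, as a power of itself, would lie in every F_(-n). *)
Lemma one_notin_neg1 : ~ F (- 1) 1.
Proof.
move=> F1; have /eqP : (1 : R) = 0; last by rewrite oner_eq0.
apply: (filt_separated F_filt F_sep); elim=> [|n IH].
  by rewrite oppr0; apply: filt1.
have -> : - n.+1%:Z = - 1 + - n%:Z by lia.
by rewrite -[X in F _ X](mulr1 1); apply: filtM.
Qed.

Lemma inverse_notin_neg1 (a : R) : a != 0 -> F 0 a^-1 -> ~ F (- 1) a.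
Proof.
move=> /unit_of_neq0 a_unit FVa Fa; apply: one_notin_neg1.
by rewrite -(mulrV a_unit) -[- 1]addr0; apply: filtM.
Qed.

(** The left ideal B a is some F_(-k), and k = 0 is the only possibility when a
    is outside F_(-1). *)
Lemma inverse_in_subring a : F 0 a -> ~ F (- 1) a -> F 0 a^-1.
Proof.
move=> Fa NFa; have a_neq0 : a != 0.
  by apply/eqP => a0; apply: NFa; rewrite a0; apply: filt0.
have a_unit := unit_of_neq0 a_neq0; have [k aE] := principal_ideal Fa a_neq0.
have Fka : F (- k%:Z) a by apply/aE; exists 1; rewrite ?mul1r //; apply: filt1.
have k0 : k = 0%N.
  by case: k Fka {aE} => // k Fka; case: NFa; apply: filtS Fka => //; lia.
have [b Fb ba] : exists2 b, F 0 b & 1 = b * a.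
  by apply/aE; rewrite k0 oppr0; apply: filt1.
by rewrite -[a^-1]mul1r ba mulrK.
Qed.

(** * The uniformizer *)

Variables (e : nat) (pi : R).
Hypothesis e_gt0 : (0 < e)%N.
Hypothesis F_e : F (- e%:Z) = F (- 1).
Hypothesis Fpi : F (- e%:Z) pi.
Hypothesis NFpi : ~ F (- e%:Z - 1) pi.

Lemma uniformizer_unit : pi \is a GRing.unit.
Proof.
apply: unit_of_neq0; apply/eqP => pi0.
by apply: NFpi; rewrite pi0; apply: filt0.
Qed.
Let pi_unit := uniformizer_unit.

Lemma uniformizer_subring : F 0 pi.
Proof. by apply: filtS Fpi => //; lia. Qed.

(** The left ideal B pi is some F_(-k); it lies between F_(-e) and F_(-1),
    which are equal. *)
Lemma uniformizerP a : F (- 1) a <-> F 0 (a * pi^-1).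
Proof.
have pi_neq0 : pi != 0 by apply: contraTneq pi_unit => ->; rewrite unitr0.
have [k piE] := principal_ideal uniformizer_subring pi_neq0.
have Fkpi : F (- k%:Z) pi.
  by apply/piE; exists 1; rewrite ?mul1r //; apply: filt1.
have le_ke : (k <= e)%N.
  by case: leqP => // lt_ek; case: NFpi; apply: filtS Fkpi => //; lia.
have k_gt0 : (0 < k)%N.
  case: k piE {Fkpi le_ke} => // piE.
  have /piE[b Fb bpi] := filt1 F_filt; case: one_notin_neg1.
  by rewrite bpi -[- 1]add0r; apply: filtM => //; rewrite -F_e.
split=> [Fa|Fapi].
  have /piE[b Fb ->] : F (- k%:Z) a.
    by apply: (filtS F_filt (m := - e%:Z)); [lia | rewrite F_e].
  by rewrite mulrK.
apply: (filtS F_filt (m := - k%:Z)); first lia.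
by apply/piE; exists (a * pi^-1); rewrite ?mulrVK.
Qed.

(** Since F_(-1) = B pi is also a right ideal, pi B is contained in B pi. *)
Lemma conj_uniformizer b : F 0 b -> F 0 (pi * b * pi^-1).
Proof.
move=> Fb; apply/uniformizerP; rewrite -[- 1]addr0.
by apply: filtM => //; rewrite -F_e.
Qed.

(** If y, the conjugate of b, were outside B, its inverse would lie in the
    maximal ideal B pi; conjugating back by pi, so would the inverse of b,
    although b is in B. *)
Lemma conjV_uniformizer b : F 0 b -> F 0 (pi^-1 * b * pi).
Proof.
have [->|b_neq0 Fb] := eqVneq b 0; first by rewrite mulr0 mul0r.
have b_unit := unit_of_neq0 b_neq0; set y := pi^-1 * b * pi.
have y_unit : y \is a GRing.unit by rewrite !unitrMr ?unitrV // unitrMl ?unitrV.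
have y_neq0 : y != 0 by apply: contraTneq y_unit => ->; rewrite unitr0.
have [//|FVy] := subring_total y_neq0.
have [/uniformizerP FVypi|NFVy] := pselect (F (- 1) y^-1); last first.
  by rewrite -[y]invrK; apply: inverse_in_subring.
have VyE : y^-1 * pi^-1 = pi^-1 * b^-1.
  by rewrite /y !invrM ?unitrMr ?unitrV // invrK !mulrA mulrK // unitrV.
case: (@inverse_notin_neg1 b^-1); rewrite ?invrK ?invr_eq0 //.
rewrite -(mulVKr pi_unit b^-1) -VyE -[- 1]addr0.
by apply: filtM => //; rewrite -F_e.
Qed.

Lemma conj_uniformizerX (m : int) b : F 0 b -> F 0 (pi ^ m * b * pi ^ (- m)).
Proof.
elim/int_rect: m b => [b|m IH b Fb|m IH b Fb].
- by rewrite oppr0 !expr0z mul1r mulr1.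
- have -> : pi ^ m.+1%:Z * b * pi ^ (- m.+1%:Z) =
            pi * (pi ^ m%:Z * b * pi ^ (- m%:Z)) * pi^-1.
    have -> : - m.+1%:Z = - m%:Z + - 1 by lia.
    have -> : m.+1%:Z = 1 + m%:Z by lia.
    by rewrite !exprzDr // !mulrA.
  exact/conj_uniformizer/IH.
- have -> : pi ^ (- m.+1%:Z) * b * pi ^ (- - m.+1%:Z) =
            pi^-1 * (pi ^ (- m%:Z) * b * pi ^ (- - m%:Z)) * pi.
    have -> : - m.+1%:Z = - 1 + - m%:Z by lia.
    have -> : - (- 1 + - m%:Z) = - - m%:Z + 1 by lia.
    by rewrite !exprzDr // !mulrA.
  exact/conjV_uniformizer/IH.
Qed.

(** The fractional ideal B pi^m. *)
Definition uniformizer_power (m : int) : set R :=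
  [set a | F 0 (a * pi ^ (- m))].
Local Notation Q := uniformizer_power.

Lemma uniformizer_power0 : Q 0 = F 0.
Proof. by apply/seteqP; split => a; rewrite /Q /= oppr0 expr0z mulr1. Qed.

Lemma uniformizer_power1 : Q 1 = F (- 1).
Proof. by apply/seteqP; split => a /uniformizerP. Qed.

(** Since pi^m normalises B, B pi^m B pi^n is contained in B pi^(m + n). *)
Lemma uniformizer_powerM m n a b : Q m a -> Q n b -> Q (m + n) (a * b).
Proof.
rewrite /Q /= => Qa Qb.
have -> : a * b * pi ^ (- (m + n)) =
    (a * pi ^ (- m)) * (pi ^ m * (b * pi ^ (- n)) * pi ^ (- m)).
  have -> : - (m + n) = - n + - m by lia.
  rewrite exprzDr // !mulrA -[_ * pi ^ (- m) * pi ^ m]mulrA -exprzDr //.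
  by rewrite addNr expr0z mulr1.
by rewrite -[0]addr0; apply: filtM => //; apply: conj_uniformizerX.
Qed.

Lemma uniformizerX_in (m : int) : Q m (pi ^ m).
Proof. by rewrite /Q /= -exprzDr // addrN expr0z; apply: filt1. Qed.

Lemma uniformizerXn_in (n : nat) : F (- n%:Z) (pi ^+ n).
Proof.
elim: n => [|n IH]; first by rewrite oppr0; apply: filt1.
have -> : - n.+1%:Z = - 1 + - n%:Z by lia.
by rewrite exprS; apply: filtM => //; rewrite -F_e.
Qed.

Lemma uniformizer_powerS m n a : m <= n -> Q n a -> Q m a.
Proof.
rewrite /Q /= => le_mn Qa.
have -> : - m = - n + (n - m) by lia.
rewrite exprzDr // mulrA -[0]addr0; apply: filtM => //.
have -> : n - m = absz (n - m)%R by lia.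
by apply: filtS (uniformizerXn_in _) => //; lia.
Qed.

Lemma uniformizer_power_sub_filt (n : nat) a : Q n a -> F (- n%:Z) a.
Proof.
rewrite /Q /= => Qa; rewrite -[- _]add0r.
have -> : a = a * pi ^ (- n%:Z) * pi ^+ n.
  by rewrite -mulrA -[pi ^+ n]/(pi ^ n%:Z) -exprzDr // addNr expr0z mulr1.
by apply: filtM => //; apply: uniformizerXn_in.
Qed.

Lemma uniformizer_power_succ m a : Q (m + 1) a <-> F (- 1) (a * pi ^ (- m)).
Proof.
apply: iff_trans (iff_sym (uniformizerP _)).
by rewrite /Q /= opprD exprzDr // mulrA.
Qed.

Lemma uniformizer_le m n : Q m (pi ^ n) -> m <= n.
Proof.
move=> Qpi; have [//|lt_nm] := leP m n.
have /uniformizer_power_succ : Q (n + 1) (pi ^ n).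
  by apply: uniformizer_powerS Qpi; lia.
by rewrite -exprzDr // subrr expr0z => /one_notin_neg1.
Qed.

(** Otherwise a would lie in B pi^n, hence in F_(-n), for every large n. *)
Lemma exists_level_ge (m : int) (a : R) :
  a != 0 -> Q m a -> exists n, Q n a /\ ~ Q (n + 1) a.
Proof.
move=> a_neq0 Qa; apply: contra_notP (elimN eqP a_neq0) => nolevel.
have Qup (k : nat) : Q (m + k%:Z) a.
  elim: k => [|k IH]; first by rewrite addr0.
  have -> : m + k.+1%:Z = m + k%:Z + 1 by lia.
  by apply: contra_notP nolevel => NQ; exists (m + k%:Z).
apply: (filt_separated F_filt F_sep) => n.
apply: uniformizer_power_sub_filt.
by apply: uniformizer_powerS (Qup (n + absz m)%N); lia.
Qed.

Lemma level_inverse m a : Q m a -> ~ Q (m + 1) a -> F 0 (a * pi ^ (- m))^-1.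
Proof.
by move=> Qa NQa; apply: inverse_in_subring => // /uniformizer_power_succ.
Qed.

(** For a outside B, the inverse of a is in B, and the level of a is the
    opposite of that of its inverse. *)
Lemma exists_level (a : R) : a != 0 -> exists m, Q m a /\ ~ Q (m + 1) a.
Proof.
move=> a_neq0; have a_unit := unit_of_neq0 a_neq0.
have [Fa|FVa] := subring_total a_neq0.
  by apply: (@exists_level_ge 0); rewrite ?uniformizer_power0.
have [||m [QVa NQVa]] := @exists_level_ge 0 a^-1;
  rewrite ?invr_eq0 ?uniformizer_power0 //.
apply: (@exists_level_ge (- m)) => //; rewrite /Q /=.
have := conj_uniformizerX (- m) (level_inverse QVa NQVa).
rewrite invrM ?unitrV ?unitrXz // invrK.
have -> : (pi ^ (- m))^-1 = pi ^ m by rewrite invr_expz opprK.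
by rewrite !mulrA -exprzDr // addNr expr0z mul1r.
Qed.

(** At its level m, an element a is a unit of B times pi^m, so B a = B pi^m. *)
Lemma level_sub_filt n m a : Q m a -> ~ Q (m + 1) a -> F n a -> Q m `<=` F n.
Proof.
move=> Qa NQa Fa b Qb; have u_unit := level_inverse Qa NQa.
have a_unit : a \is a GRing.unit.
  apply: unit_of_neq0; apply/eqP => a0; apply: NQa.
  by rewrite a0 /Q /= mul0r; apply: filt0.
have -> : b = b * pi ^ (- m) * (a * pi ^ (- m))^-1 * a.
  rewrite invrM ?unitrXz // !mulrA mulrVK //.
  by rewrite mulrK ?unitrXz.
by rewrite -[n]add0r; apply: filtM => //; rewrite -[0]addr0; apply: filtM.
Qed.

(** F_n contains B pi^m for each level m of its elements, and there is a least
    such m because F_n is not the whole ring. *)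
Lemma filt_uniformizer_power n : exists m, F n = Q m.
Proof.
have [a0 Fa0 a0_neq0] := filt_neq0 F_filt F_neq0 n.
have [m1 [Qa0 NQa0]] := exists_level a0_neq0.
have Q1F := level_sub_filt Qa0 NQa0 Fa0.
have [b NFb] : exists b, ~ F n b.
  apply: contra_notP (F_neqT (n := n)) => nob; apply/seteqP; split=> // b _.
  by apply: contra_notP nob => NFb; exists b.
have b_neq0 : b != 0 by apply/eqP => b0; apply: NFb; rewrite b0; apply: filt0.
have [m0 [Qb _]] := exists_level b_neq0.
have [m [QF NQF]] : exists m, Q m `<=` F n /\ ~ Q (m - 1) `<=` F n.
  apply: contra_notP NFb => nomin.
  have QFdown (k : nat) : Q (m1 - k%:Z) `<=` F n.
    elim: k => [|k IH]; first by rewrite subr0.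
    have -> : m1 - k.+1%:Z = m1 - k%:Z - 1 by lia.
    by apply: contra_notP nomin => NQ; exists (m1 - k%:Z).
  apply: (QFdown (absz (m1 - m0)%R)).
  by apply: uniformizer_powerS Qb; lia.
exists m; apply/seteqP; split => // a Fa.
have [->|a_neq0] := eqVneq a 0; first by rewrite /Q /= mul0r; apply: filt0.
have [k [Qa NQa]] := exists_level a_neq0.
have [le_mk|lt_km] := leP m k; first exact: uniformizer_powerS Qa.
case: NQF => c Qc; apply: (level_sub_filt Qa NQa Fa).
by apply: uniformizer_powerS Qc; lia.
Qed.

Lemma uniformizer_power_inj : injective Q.
Proof.
move=> m n Qmn; apply: le_anti; apply/andP; split; apply: uniformizer_le.
  by rewrite Qmn; apply: uniformizerX_in.
by rewrite -Qmn; apply: uniformizerX_in.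
Qed.

(** Otherwise F_(-1), F_(-1), F_(-2), F_(-3), ... would be a glider. As a
    subsequence of the negative part it would start at an index at least 1, so
    its term F_(-e) would have index at least e + 1; but F_(-e) is not contained
    in F_(-e-1). *)
Lemma exists_strong_index : exists j : nat, (0 < j)%N /\
  exists a b, [/\ F j%:Z a, F (- j%:Z) b & ~ F (- 1) (a * b)].
Proof.
apply: contrapT => nostrong.
pose N (n : nat) : set R := F (- (maxn n 1)%:Z).
have N_sub : is_subglider F (N : nat -> set R^o) (negative_part F).
  split=> [|n a]; last by apply: filtS => //; lia.
  split=> [n a|n|n a x Fa Nx|i n a x le_in Fa Nx].
  - by apply: filtS => //; lia.
  - exact: filt_subgroup.
  - by rewrite /N -[- _]add0r; apply: filtM.
  - have [lt_in|le_ni] := ltP i n%:Z.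
      by apply: (filtS F_filt _ (filtM F_filt Fa Nx)); lia.
    have {le_ni} i_n : i = n by apply: le_anti; rewrite le_in.
    rewrite {}i_n {le_in} in Fa *; rewrite subrr /N.
    have [n0|n_gt0] := posnP n.
      by move: Nx; rewrite n0 in Fa *; rewrite /N -[- _]add0r; apply: filtM.
    apply: contra_notP nostrong => Nax; exists n; split => //.
    by exists a, x; split => //; apply: filtS Nx => //; lia.
have N_neq0 n : exists2 x, N n x & x != 0 by apply: filt_neq0.
have [alpha NE alpha_inc] := subglider_T3 N_sub N_neq0.
have alpha0 : (0 < alpha 0)%N.
  case: posnP => // alpha0; case: one_notin_neg1.
  by have := NE 0%N; rewrite /N alpha0 oppr0 /= => ->; apply: filt1.
have := alpha_inc 0%N e; rewrite add0n => le_alpha; case: NFpi.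
have Npi : N e pi by apply: filtS Fpi => //; lia.
by move: Npi; rewrite NE; apply: filtS => //; lia.
Qed.

(** The function p with F_(-n) = B pi^(p n) satisfies the assumptions of
    [step_ceil]. *)
Lemma filt_ceil (n : int) (i : nat) :
  (i < e)%N -> F (n * e%:Z + i%:Z) = Q (- n).
Proof.
have [p pE] := choice (fun k : int => filt_uniformizer_power (- k)).
have p_in k : F (- k) (pi ^ p k) by rewrite pE; apply: uniformizerX_in.
have p_le m k : F (- k) (pi ^ m) -> p k <= m.
  by rewrite pE; apply: uniformizer_le.
have p_homo (m k : int) : m <= k -> p m <= p k.
  by move=> le_mn; apply: p_le; apply: (filtS F_filt _ (p_in k)); lia.
have p_subadd (m k : int) : p (m + k) <= p m + p k.
  by apply: p_le; rewrite exprzDr // opprD; apply: filtM.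
have p0 : p 0 = 0.
  by apply: uniformizer_power_inj; rewrite -pE oppr0 uniformizer_power0.
have p1 : p 1 = 1.
  by apply: uniformizer_power_inj; rewrite -pE uniformizer_power1.
have pe : p e%:Z = 1.
  by apply: uniformizer_power_inj; rewrite -pE F_e uniformizer_power1.
have pe1 : 2 <= p (e%:Z + 1).
  have [//|p_le1] := leP 2 (p (e%:Z + 1)); case: NFpi.
  rewrite -opprD pE; apply: (@uniformizer_powerS _ 1); first by rewrite -ltzD1.
  by rewrite uniformizer_power1 -F_e.
have p_embed (s : nat) : exists2 alpha : nat -> nat,
    (forall k : nat, p (alpha k)%:Z = p k%:Z + s%:Z) &
    forall m k : nat, (alpha m + k <= alpha (m + k))%N.
  have Fpis : F 0 (pi ^+ s) by apply: filtS (uniformizerXn_in s) => //; lia.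
  have pis_neq0 : pi ^+ s != 0.
    by apply/eqP => pis0; have := unitrX s pi_unit; rewrite pis0 unitr0.
  have [alpha alphaE alpha_inc] := right_multiple_shift Fpis pis_neq0.
  exists alpha => // k; apply: le_anti; apply/andP; split.
    apply: p_le; rewrite -alphaE exprzDr //.
    by exists (pi ^ p k%:Z).
  have [b Fb piE] : right_multiple (pi ^+ s) k (pi ^ p (alpha k)%:Z).
    by rewrite alphaE.
  apply: uniformizer_le; rewrite piE; apply: uniformizer_powerM.
    by rewrite -pE.
  exact: uniformizerX_in.
have [j [j_gt0 [a [b [Fa Fb NFab]]]]] := exists_strong_index.
have p_oppj : p (- j%:Z) = - p j%:Z.
  have := p_subadd (- j%:Z) j%:Z; rewrite addNr p0 => sum_ge0.
  have [sum_le0|sum_gt0] := leP (p (- j%:Z) + p j%:Z) 0; first lia.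
  case: NFab; rewrite -uniformizer_power1.
  apply: (@uniformizer_powerS _ (p (- j%:Z) + p j%:Z)); first lia.
  by apply: uniformizer_powerM; rewrite -pE ?opprK.
move=> lt_ie; rewrite -[_ + _]opprK pE.
by rewrite (step_ceil p_homo p_subadd p0 p1 pe pe1 p_embed j_gt0 p_oppj).
Qed.

Lemma strong_step_of_irreducible : strong_step_filtration e F.
Proof.
have FE n : F (n * e%:Z) = Q (- n) by rewrite -[_ * _]addr0; apply: filt_ceil.
split=> [n i lt_ie|n _]; first by rewrite filt_ceil // FE.
have prod m : mul_subgroup (F (m * e%:Z)) (F (- m * e%:Z)) = F (0 * e%:Z).
  apply/seteqP; split=> [a /(filt_mul F_filt)|a Fa].
    by rewrite -mulrDl addrN.
  exists [:: (a * pi ^ (- m), pi ^ m)].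
    move=> _ /[!inE]/eqP-> /=; rewrite !FE opprK.
    split; last exact: uniformizerX_in.
    rewrite -[X in Q X]add0r; apply: uniformizer_powerM; last first.
      exact: uniformizerX_in.
    by rewrite uniformizer_power0; move: Fa; rewrite mul0r.
  by rewrite big_seq1 /= -mulrA -exprzDr // addNr expr0z mulr1.
by split; [apply: prod | have := prod (- n); rewrite opprK].
Qed.

End IrreducibleNegativePart.

Theorem proposition2p2 (K : fieldType) (A : falgType K) (F : int -> set A)
    (hA : central_simple A)
    (hF : is_filtration F)
    (hsep : separated_filtration F)
    (hexh : exhaustive_filtration F)
    (hunb : not_bounded_filtration F)
    (hK : nontrivial_negative_part (induced_filtration F))
    (hirr : irreducible_glider F (negative_part F))
    (e : nat)
    (he1 : (1 <= e)%N)
    (he : F (- e%:Z - 1) `<` F (- e%:Z))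
    (hmin : forall d : nat, (1 <= d)%N -> F (- d%:Z - 1) `<` F (- d%:Z) ->
      (e <= d)%N) :
  strong_step_filtration e F.
Proof.
have [F_neq0 F_neqT] := hunb.
have F_central n : exists c : A, [/\ F (- n%:Z) c, c \is a GRing.unit &
    forall x, c * x = x * c].
  have [k Fk k_neq0] : exists2 k : K, F (- n%:Z) k%:A & k != 0.
    apply: contra_notP (hK n) => nok; apply/seteqP; split=> [k Fk|_ ->] /=.
      by apply: contra_notP nok => /eqP k_neq0; exists k.
    by rewrite /induced_filtration /= scale0r; apply: filt0.
  exists k%:A; split=> // [|x]; last by rewrite mulr_algl mulr_algr.
  by rewrite scaler_unit ?unitfE ?unitr1.
(* The minimality of e forces equality at each step from F_(-1) to F_(-e). *)
have F_e : F (- e%:Z) = F (- 1).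
  have F_const (d : nat) : (d < e)%N -> F (- d.+1%:Z) = F (- 1).
    elim: d => [//|d IH lt_de]; rewrite -IH ?(ltnW lt_de) //.
    have [//|neq] := pselect (F (- d.+2%:Z) = F (- d.+1%:Z)).
    suff : (e <= d.+1)%N by rewrite leqNgt lt_de.
    apply: hmin => //; have -> : - d.+1%:Z - 1 = - d.+2%:Z by lia.
    rewrite properEneq; split; first exact/eqP.
    by move=> a; apply: filtS => //; lia.
  by case: e he1 F_const {he hmin} => // d _ -> .
have [pi Fpi NFpi] : exists2 pi, F (- e%:Z) pi & ~ F (- e%:Z - 1) pi.
  have [_ /existsNP[pi /not_implyP[Fpi NFpi]]] := he.
  by exists pi.
apply: (strong_step_of_irreducible hF hsep hexh F_neq0 _ F_central hirr
          he1 F_e Fpi NFpi).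
by move=> n Fn; apply: F_neqT; exists n.
Qed.
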